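(* Let $n\ge1$ and $a\ge1$ be integers, and let $k\ge 0$. Starting from the identity arrangement of a deck of $n$ cards, perform $k$ independent $a$-shuffles (Gilbert–Shannon–Reeds model). Then the probability that the resulting permutation has sign $1$ equals \[ \frac12+\frac{1}{2a^{k\lfloor n/2\rfloor}}. \]
   Context: An $a$-shuffle (GSR model) of a deck of $n$ cards: choose $(j_1,\dots,j_a)$ with $j_i\ge0$, $\sum j_i=n$, with probability $\binom{n}{j_1,\dots,j_a}/a^n$; cut the top $j_1$ cards, the next $j_2$ cards, etc., into $a$ packets; then drop cards one at a time, where if packet $i$ currently has $A_i$ cards, the next card is dropped from packet $i$ with probability $A_i/(A_1+\cdots+A_a)$, until all cards are dropped. The resulting arrangement is a permutation $w\in S_n$; started from the identity, the probability of obtaining $w$ after one $a$-shuffle is $\binom{n+a-\mathrm{des}(w^{-1})-1}{n}/a^n$, where $\mathrm{des}(u)=|\{1\le i\le n-1:u(i)>u(i+1)\}|$. The sign $\mathrm{sgn}(w)$ is the usual sign of a permutation. *)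

(* Defs.v *)
From mathcomp Require Import all_boot all_order all_algebra all_fingroup.

Set Implicit Arguments.
Unset Strict Implicit.
Unset Printing Implicit Defensive.

Import Order.TTheory GRing.Theory Num.Theory.
Local Open Scope ring_scope.

(* Positions in the deck and cards are both numbered by 'I_n, from the top.   *)
(* An arrangement w : 'S_n has card (w p) in position p; the identity is the  *)
(* initial arrangement. With this convention the cards of each packet occur   *)
(* in increasing order in w, i.e., w^-1 has at most a - 1 descents.           *)

Section Shuffle.

Variables (R : realFieldType) (n a : nat).

(* j i is the size of packet i.                                               *)
Definition cut := {ffun 'I_a -> 'I_n.+1}.

Definition valid_cut (j : cut) : bool := (\sum_(i < a) j i == n)%N.

Definition cut_prob (j : cut) : R :=
  n`!%:R / (\prod_(i < a) (j i)`!)%N%:R / a%:R ^+ n.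

(* c t is the packet from which the (t+1)-st card is dropped.                 *)
Definition drops := {ffun 'I_n -> 'I_a}.

Definition left_in (j : cut) (c : drops) (t : nat) (i : 'I_a) : nat :=
  (j i - #|[set s : 'I_n | (s < t)%N && (c s == i)]|)%N.

(* A sequence of drops that takes a card from an exhausted packet has a zero  *)
(* factor; in particular the truncated subtraction in left_in is harmless.    *)
Definition drop_prob (j : cut) (c : drops) : R :=
  \prod_(t < n) ((left_in j c t (c t))%:R / (\sum_(i < a) left_in j c t i)%N%:R).

(* Cards fall from the bottom of the packets: when left_in j c t i cards      *)
(* remain in packet i, the next one to fall from it is the last of these.     *)
Definition dropped_card (j : cut) (c : drops) (t : 'I_n) : nat :=
  (\sum_(i < a | (i < c t)%N) j i + (left_in j c t (c t)).-1)%N.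

(* The first card dropped ends up at the bottom of the deck.                  *)
Definition shuffle_result (j : cut) (c : drops) (w : 'S_n) : bool :=
  [forall t : 'I_n, w (rev_ord t) == dropped_card j c t :> nat].

Definition shuffle_law (w : 'S_n) : R :=
  \sum_(j : cut | valid_cut j) \sum_(c : drops | shuffle_result j c w)
    cut_prob j * drop_prob j c.

End Shuffle.

(* Shuffling the deck w by s moves the card in position (s p) to position p,  *)
(* so the new arrangement is p |-> w (s p), which is (s * w)%g.               *)
Definition rearrange (n : nat) (w s : 'S_n) : 'S_n := (s * w)%g.

Definition shuffled_deck (n k : nat) (s : k.-tuple 'S_n) : 'S_n :=
  foldl (@rearrange n) 1%g s.

(* Independence: the k shuffles are distributed by the product of their laws. *)
Definition shuffles_prob (R : realFieldType) (n a k : nat) (E : pred 'S_n) : R :=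
  \sum_(s : k.-tuple 'S_n | E (shuffled_deck s))
    \prod_(i < k) shuffle_law R a (tnth s i).

Definition sgn (n : nat) (w : 'S_n) : int := (-1) ^+ odd_perm w.

(* Main.v *)
(* A pair (cut, drop sequence c) of nonzero probability has packet sizes equal
   to the fibre sizes of c, and then has probability a^-n whatever c is: a
   shuffle is given by a uniform word c in [a]^n, read from the bottom of the
   deck. The resulting arrangement is the standardization of the reversed word,
   which has the same inversions as that word. Let S_n be the sum over words of
   length n of (-1)^(number of inversions). In S_(n+2), words with distinct first
   two letters cancel in pairs, so S_(n+2) = a S_n and the expected sign after
   one shuffle is a^(ceil(n/2) - n) = a^-floor(n/2). The sign being
   multiplicative, the expected sign after k shuffles is the k-th power. *)
Require Import Defs.
From mathcomp Require Import all_boot all_order all_algebra all_fingroup.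

Import Order.TTheory GRing.Theory Num.Theory.
Local Open Scope ring_scope.

(** * Permutation signs through inversions *)

(* The Vandermonde determinant of [0, ..., n - 1], with columns permuted by s. *)
Lemma sign_perm_inversions (R : realDomainType) (n : nat) (s : 'S_n) :
  (-1) ^+ odd_perm s
    = \prod_(i < n) \prod_(j < n | (i < j)%N) (-1) ^+ (s j < s i)%N :> R.
Proof.
pose V (u : 'S_n) : R :=
  \prod_(i < n) \prod_(j < n | (i < j)%N) ((u j)%:R - (u i)%:R).
have VE u : V u = (-1) ^+ odd_perm u * V 1%g.
  have detV v : V v = \det (Vandermonde n (\row_j (v j)%:R)).
    rewrite det_Vandermonde; apply: eq_bigr => i _; apply: eq_bigr => j _.
    by rewrite !mxE.
  rewrite !detV -(odd_permV u) -det_perm mulrC -det_mulmx -col_permE.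
  by congr (\det _); apply/matrixP => i j; rewrite !mxE perm1.
have V_gt0 : 0 < V 1%g.
  apply: prodr_gt0 => i _; apply: prodr_gt0 => j lt_ij.
  by rewrite !perm1 subr_gt0 ltr_nat.
(* Each factor of [V s] is negative exactly at an inversion. Since [|V s| = V 1], comparing with
   [VE] and cancelling [V 1 > 0] gives the claim. *)
have : V s = (\prod_(i < n) \prod_(j < n | (i < j)%N) (-1) ^+ (s j < s i)%N)
             * `|V s|.
  rewrite {2}/V normr_prod -big_split; apply: eq_bigr => i _ /=.
  rewrite normr_prod -big_split; apply: eq_bigr => j _ /=.
  have := ler_nat R (s i) (s j).
  case: ltnP => _ le_ij.
    by rewrite expr1 ltr0_norm ?mulN1r ?opprK // subr_lt0 ltNge le_ij.
  by rewrite expr0 mul1r ger0_norm // subr_ge0 le_ij.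
rewrite VE normrM normr_sign mul1r (gtr0_norm V_gt0).
exact/mulIf/lt0r_neq0.
Qed.

(** * Sums over tuples and signed sums over words *)

Lemma big_tuple_cons (R : Type) (idx : R) (op : Monoid.com_law idx)
    (T : finType) (n : nat) (F : n.+1.-tuple T -> R) :
  \big[op/idx]_(t : n.+1.-tuple T) F t
    = \big[op/idx]_(x : T) \big[op/idx]_(t : n.-tuple T) F [tuple of x :: t].
Proof.
rewrite pair_big (reindex (fun p : T * n.-tuple T => [tuple of p.1 :: p.2])) //=.
exists (fun t : n.+1.-tuple T => (thead t, [tuple of behead t])) => [[x t]|t] _.
  by congr pair; apply: val_inj.
by rewrite [RHS]tuple_eta.
Qed.

Lemma big_tuple0 (R : Type) (idx : R) (op : Monoid.com_law idx)
    (T : finType) (F : 0.-tuple T -> R) :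
  \big[op/idx]_(t : 0.-tuple T) F t = F [tuple].
Proof. by rewrite (big_pred1 [tuple]) // => t; apply/esym/eqP/tuple0. Qed.

Lemma sum_tuple_prod (R : comPzSemiRingType) (T : finType) (f : T -> R) (k : nat) :
  \sum_(t : k.-tuple T) \prod_(i < k) f (tnth t i) = (\sum_x f x) ^+ k.
Proof.
elim: k => [|k IHk]; first by rewrite big_tuple0 big_ord0.
rewrite big_tuple_cons exprS mulr_suml; apply: eq_bigr => x _.
rewrite -IHk mulr_sumr; apply: eq_bigr => t _.
rewrite big_ord_recl tnth0; congr (_ * _).
by apply: eq_bigr => i _; rewrite tnthS.
Qed.

(** Same shape as [sign_perm_inversions], so that the two can be matched factor by factor; a pair of
    equal letters contributes 1. *)
Definition word_sign (R : pzRingType) (n a : nat) (t : n.-tuple 'I_a) : R :=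
  \prod_(i < n) \prod_(j < n | (i < j)%N) (-1) ^+ (tnth t j < tnth t i)%N.

Lemma word_sign_cons (R : comPzRingType) (n a : nat) (x : 'I_a) (t : n.-tuple 'I_a) :
  word_sign R n.+1 a [tuple of x :: t]
    = (\prod_(i < n) (-1) ^+ (tnth t i < x)%N) * word_sign R n a t.
Proof.
rewrite /word_sign big_ord_recl; congr (_ * _).
  rewrite big_mkcond big_ord_recl /= mul1r.
  by apply: eq_bigr => i _; rewrite tnth0 tnthS.
apply: eq_bigr => i _; rewrite big_mkcond big_ord_recl /= mul1r [RHS]big_mkcond.
by apply: eq_bigr => j _; rewrite !tnthS.
Qed.

(* Swapping the first two letters x <> y changes the sign, whereas a repeated
   pair x, x does not affect the sign of the rest of the word. *)
Lemma sum_word_sign (R : realDomainType) (n a : nat) :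
  \sum_(t : n.-tuple 'I_a) word_sign R n a t = a%:R ^+ uphalf n.
Proof.
(* The recursion removes two letters, so two consecutive lengths are carried through the
   induction. *)
suff: \sum_(t : n.-tuple 'I_a) word_sign R n a t = a%:R ^+ uphalf n /\
      \sum_(t : n.+1.-tuple 'I_a) word_sign R n.+1 a t = a%:R ^+ uphalf n.+1.
  by case.
elim: n => [|n [IHn IHn1]]; split=> //.
- by rewrite big_tuple0 /word_sign big_ord0.
- rewrite big_tuple_cons (eq_bigr (fun=> 1)) => [|x _].
    by rewrite sumr_const card_ord.
  by rewrite big_tuple0 word_sign_cons big_ord0 /word_sign big_ord0 mulr1.
rewrite /= exprS -IHn mulr_sumr big_tuple_cons.
rewrite (eq_bigr (fun x => \sum_y \sum_(t : n.-tuple 'I_a)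
           word_sign R n.+2 a [tuple of x :: [tuple of y :: t]])) => [|x _];
  last by rewrite big_tuple_cons.
under eq_bigr do rewrite exchange_big.
rewrite exchange_big; apply: eq_bigr => t _ /=.
(* [g x] is the sign of the inversions between a leading letter [x] and the rest [t]; [h x y] is the
   sign of all inversions involving the two leading letters. *)
pose g (x : 'I_a) : R := \prod_(i < n) (-1) ^+ (tnth t i < x)%N.
pose h (x y : 'I_a) : R := (-1) ^+ (y < x)%N * g x * g y.
have gg x : g x * g x = 1.
  by rewrite -big_split big1 // => i _; rewrite /= -expr2 sqrr_sign.
have -> : \sum_x \sum_y word_sign R n.+2 a [tuple of x :: [tuple of y :: t]]
          = (\sum_x \sum_y h x y) * word_sign R n a t.
  rewrite mulr_suml; apply: eq_bigr => x _; rewrite mulr_suml.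
  apply: eq_bigr => y _; rewrite !word_sign_cons big_ord_recl tnth0.
  rewrite /h -!mulrA; congr (_ * (_ * _)).
  by apply: eq_bigr => i _; rewrite tnthS.
congr (_ * _).
have h_sym x y : h x y + h y x = 2 * (x == y)%:R.
  rewrite /h; have [<-|ne_xy] := eqVneq x y.
    by rewrite ltnn mul1r gg mulr1 -mulr2n.
  rewrite mulr0 -!mulrA [g y * g x]mulrC -mulrDl.
  have: x != y :> nat by [].
  by case: ltngtP => // _ _; rewrite ?expr1 ?expr0 ?addNr ?subrr mul0r.
(* Adding the double sum to itself with [x] and [y] exchanged leaves only the diagonal, which
   contributes 2 for each of the [a] letters. *)
apply: (@mulfI _ 2%:R); first by rewrite pnatr_eq0.
rewrite [LHS]mulr_natl mulr2n {2}exchange_big -big_split /=.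
under eq_bigr do rewrite -big_split /=.
under eq_bigr do under eq_bigr do rewrite h_sym.
under eq_bigr => x _.
  rewrite -mulr_sumr (bigD1 x) //= eqxx big1 ?addr0 => [|y].
    over.
  by rewrite eq_sym => /negbTE->.
by rewrite sumr_const card_ord mulr1 mulr_natr.
Qed.

(** * Counting along subsets and fibres *)

(** In increasing order the elements of [A] have 0, 1, 2, ... predecessors in [A], so the factors
    are [#|A|], [#|A| - 1], ..., 1. The induction removes the minimum. *)
Lemma prod_card_remaining (n : nat) (A : {set 'I_n}) :
  (\prod_(t in A) (#|A| - #|[set s in A | (s < t)%N]|) = #|A|`!)%N.
Proof.
have [m] := ubnP #|A|; elim: m A => // m IHm A; rewrite ltnS => leA.
have [->|/set0Pn[t0' At0']] := eqVneq A set0; first by rewrite big_set0 cards0.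
have [t0 At0 min_t0] : exists2 t0, t0 \in A & {in A, forall t : 'I_n, t0 <= t}%N.
  by case: (arg_minnP (fun t : 'I_n => t : nat) At0') => t0; exists t0.
have cardA := cardsD1 t0 A; rewrite At0 add1n in cardA.
rewrite (big_setD1 t0) //=; set X := #|[set _ in _ | _]|.
have -> : X = 0%N.
  apply: eq_card0 => s; rewrite inE; apply/negP => /andP[/min_t0].
  by rewrite leqNgt => /negbTE->.
rewrite subn0 {1 3}cardA factS; congr (_ * _)%N.
rewrite -IHm; last by rewrite -ltnS -cardA.
apply: eq_bigr => t; rewrite !inE => /andP[ne_t At].
have lt_t : (t0 < t)%N by rewrite ltn_neqAle eq_sym [_ != _]ne_t min_t0.
have -> : [set s in A | (s < t)%N] = t0 |: [set s in A :\ t0 | (s < t)%N].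
  by apply/setP => s; rewrite !inE; case: eqVneq => //= ->; rewrite At0 lt_t.
by rewrite cardsU1 !inE eqxx /= cardA subSS.
Qed.

Lemma card_ord_lt (n : nat) (t : 'I_n) : #|[set s : 'I_n | (s < t)%N]| = t.
Proof.
rewrite -sum1_card (eq_bigl (fun s : 'I_n => (s < t)%N)) => [|s]; last by rewrite inE.
by rewrite -(big_ord_widen _ (fun=> 1%N) (ltnW (ltn_ord t))) sum1_card card_ord.
Qed.

Lemma sum_card_fibers (T I : finType) (f : T -> I) (P : pred I) (A : {set T}) :
  (\sum_(i | P i) #|[set s in A | f s == i]| = #|[set s in A | P (f s)]|)%N.
Proof.
rewrite -sum1_card (partition_big f P) => [|s]; last by rewrite inE => /andP[].
apply: eq_bigr => i Pi; rewrite -sum1_card; apply: eq_bigl => s.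
by rewrite !inE; case: eqVneq => [->|]; rewrite ?Pi ?andbT ?andbF.
Qed.

(** * From one shuffle to a uniform word *)

Section Packets.

Variables (n a : nat).
Implicit Types (j : cut n a) (c : drops n a).

(** The only valid cut compatible with the drops [c]; [inord] is harmless because a fibre has at
    most [n] elements. *)
Definition packets c : cut n a := [ffun i => inord #|[set s | c s == i]|].

Lemma packetsE c i : packets c i = #|[set s | c s == i]| :> nat.
Proof.
rewrite ffunE inordK // ltnS; apply: leq_trans (max_card _) _.
by rewrite card_ord.
Qed.

Lemma sum_packets c (P : pred 'I_a) :
  (\sum_(i | P i) packets c i = #|[set s | P (c s)]|)%N.
Proof.
transitivity #|[set s in [set: 'I_n] | P (c s)]|.
  rewrite -sum_card_fibers; apply: eq_bigr => i _; rewrite packetsE.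
  by apply: eq_card => s; rewrite !inE.
by apply: eq_card => s; rewrite !inE.
Qed.

Lemma valid_packets c : valid_cut (packets c).
Proof.
rewrite /valid_cut sum_packets (eq_card (_ : _ =i [set: 'I_n])) => [|s].
  by rewrite cardsT card_ord.
by rewrite !inE.
Qed.

Lemma prod_left_in c :
  (\prod_(t < n) left_in (packets c) c t (c t) = \prod_(i < a) (packets c i)`!)%N.
Proof.
rewrite (partition_big c predT) //=; apply: eq_bigr => i _.
rewrite packetsE -prod_card_remaining; apply: eq_big => [t|t /eqP ct].
  by rewrite inE.
rewrite /left_in packetsE ct; congr (_ - _)%N.
by apply: eq_card => s; rewrite !inE andbC.
Qed.

Lemma sum_left_in c (t : 'I_n) :
  (\sum_(i < a) left_in (packets c) c t i = n - t)%N.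
Proof.
rewrite sumnB => [|i _]; last first.
  by rewrite packetsE subset_leq_card //; apply/subsetP => s; rewrite !inE => /andP[].
congr (_ - _)%N; first exact/eqP/valid_packets.
transitivity (\sum_(i < a) #|[set s in [set s : 'I_n | (s < t)%N] | c s == i]|)%N.
  by apply: eq_bigr => i _; apply: eq_card => s; rewrite !inE.
rewrite sum_card_fibers -[RHS]card_ord_lt.
by apply: eq_card => s; rewrite !inE andbT.
Qed.

Lemma prod_sum_left_in c :
  (\prod_(t < n) \sum_(i < a) left_in (packets c) c t i = n`!)%N.
Proof.
have := prod_card_remaining n [set: 'I_n]; rewrite cardsT card_ord => <-.
apply: eq_big => [t|t _]; first by rewrite inE.
rewrite sum_left_in -[X in (_ - X)%N]card_ord_lt; congr (_ - _)%N.
by apply: eq_card => s; rewrite !inE.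
Qed.

(** Both families of packet sizes sum to [n], so if they differ, some packet has fewer cards than
    [c] drops from it. The last drop from that packet finds it empty. *)
Lemma exhausted_packet j c :
  valid_cut j -> j != packets c -> exists t : 'I_n, left_in j c t (c t) = 0%N.
Proof.
move=> /eqP sum_j ne_j.
have [i lt_i] : exists i, (j i < packets c i)%N.
  apply/existsP; apply: contraR ne_j => /existsPn ge_j; apply/eqP/ffunP => i.
  have le_j k : xpredT k -> (packets c k <= j k ?= iff (packets c k == j k :> nat))%N.
    by move=> _; split=> //; rewrite leqNgt ge_j.
  have [_] := leqif_sum le_j; rewrite (eqP (valid_packets c)) sum_j eqxx.
  by move=> /esym/forallP/(_ i)/eqP/val_inj.
have: (0 < #|[set s | c s == i]|)%N by rewrite -packetsE (leq_trans _ lt_i).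
case/card_gt0P => t0 ct0.
have [t /eqP ct max_t] : exists2 t, c t == i & forall s : 'I_n, c s == i -> (s <= t)%N.
  rewrite inE in ct0.
  by case: (@arg_maxnP _ _ (fun s => c s == i) val ct0) => t; exists t.
exists t; apply/eqP; rewrite subn_eq0 ct -ltnS (leq_trans lt_i) // packetsE.
rewrite (cardsD1 t) inE ct eqxx add1n ltnS subset_leq_card //.
apply/subsetP => s; rewrite !inE => /andP[ne_s cs]; rewrite cs andbT.
by rewrite ltn_neqAle [_ == _](negbTE ne_s); exact: max_t.
Qed.

(** For [packets c] the drop probability is the inverse of the multinomial coefficient in
    [cut_prob], which cancels. For any other valid cut a factor of [drop_prob] vanishes. *)
Lemma cut_drop_prob (R : realFieldType) j c :
  valid_cut j -> cut_prob R j * drop_prob R j c = (a%:R ^+ n)^-1 *+ (j == packets c).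
Proof.
move=> valid_j; have [->|ne_j] := eqVneq j (packets c); last first.
  have [t left0] := exhausted_packet _ _ valid_j ne_j.
  by rewrite /drop_prob (bigD1 t) //= left0 !mul0r mulr0.
rewrite /drop_prob prodf_div -!natr_prod prod_left_in prod_sum_left_in /cut_prob.
set P := (\prod_(i < a) _)%N.
have P0 : P%:R != 0 :> R by rewrite pnatr_eq0 -lt0n prodn_gt0 // => i; exact: fact_gt0.
have n0 : n`!%:R != 0 :> R by rewrite pnatr_eq0 -lt0n fact_gt0.
by rewrite mulrAC mulrA divfK // divff // mul1r.
Qed.

(** The order of the cards, expressed through their drop times: within a packet cards fall from the
    bottom, so a later drop is a smaller card. *)
Definition below c (s t : 'I_n) : bool := (c s < c t)%N || (c s == c t) && (t < s)%N.

Lemma dropped_cardE c t : dropped_card (packets c) c t = #|[set s | below c s t]|.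
Proof.
rewrite /dropped_card sum_packets -(cardsID [set s | (c s < c t)%N] [set s | below c s t]).
congr (_ + _)%N; first by apply: eq_card => s; rewrite !inE /below orbK.
rewrite /left_in packetsE -(cardsID [set s : 'I_n | (s < t)%N] [set s | c s == c t]).
rewrite [X in (_ - X)%N](_ : _ = #|[set s | c s == c t] :&: [set s : 'I_n | (s < t)%N]|);
  last by apply: eq_card => s; rewrite !inE andbC.
(* The cards left in the packet at time [t] correspond to drops at times at least [t]; the
   predecessor discards [t] itself. *)
rewrite addKn (cardsD1 t) !inE ltnn eqxx /=; apply: eq_card => s.
rewrite !inE /below -!(inj_eq val_inj) /=.
by case: (ltngtP s t); case: (ltngtP (c s) (c t)).
Qed.

(** By [dropped_cardE] a card is its rank for the strict total order [below]: transitivity gives an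
    inclusion of initial segments, strict because of the smaller element, and totality gives the
    converse. *)
Lemma dropped_card_lt c s t :
  (dropped_card (packets c) c s < dropped_card (packets c) c t)%N = below c s t.
Proof.
have below_lt u v : below c u v ->
    (dropped_card (packets c) c u < dropped_card (packets c) c v)%N.
  move=> uv; rewrite !dropped_cardE; apply/proper_card/properP; split.
    apply/subsetP => r; rewrite !inE; move: uv; rewrite /below -!(inj_eq val_inj) /=.
    case: (ltngtP (c u) (c v)) => //=; case: (ltngtP (c r) (c u)) => //=.
    - by move=> lt_ru lt_uv _ _; rewrite (ltn_trans lt_ru lt_uv).
    - by move=> -> ->.
    - by move=> lt_ru <-; rewrite lt_ru.
    by move=> -> ->; rewrite ltnn eqxx; exact: ltn_trans.
  by exists u; rewrite !inE // /below !ltnn eqxx.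
have [st|] := boolP (below c s t); first exact: below_lt.
have [->|ne_st] := eqVneq s t; first by rewrite ltnn.
move=> not_st; apply/negbTE; rewrite -leqNgt; apply/ltnW/below_lt.
move: not_st ne_st; rewrite /below -!(inj_eq val_inj) /=.
by case: (ltngtP (c s) (c t)); case: (ltngtP s t).
Qed.

Lemma dropped_card_ltn c t : (dropped_card (packets c) c t < n)%N.
Proof.
rewrite dropped_cardE -[X in (_ < X)%N](card_ord n) -cardsT.
apply/proper_card/properP; by split; [apply: subsetT | exists t; rewrite !inE // /below !ltnn andbF].
Qed.

Lemma standardization_inj c :
  injective (fun p => Ordinal (dropped_card_ltn c (rev_ord p))).
Proof.
move=> p q [eq_pq]; apply/rev_ord_inj/eqP.
have := dropped_card_lt c (rev_ord p) (rev_ord q).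
have := dropped_card_lt c (rev_ord q) (rev_ord p).
rewrite eq_pq ltnn /below -!(inj_eq val_inj) /=.
by case: (ltngtP (c _) (c _)) => //= _; case: ltngtP.
Qed.

Definition standardization c : 'S_n := perm (standardization_inj c).

Lemma shuffle_result_packets c w :
  shuffle_result (packets c) c w = (w == standardization c).
Proof.
apply/forallP/eqP => [res|-> t]; last by rewrite permE /= rev_ordK.
apply/permP => p; apply: val_inj; rewrite permE /=.
by have /eqP := res (rev_ord p); rewrite rev_ordK.
Qed.

(** Position [p] is filled at time [rev_ord p], so for [p < q] the card at [q] fell earlier. If both
    come from one packet, the card at [q] is the larger, hence ties give no inversion. *)
Lemma sign_standardization (R : realDomainType) c :
  (-1) ^+ odd_perm (standardization c)
    = word_sign R n a [tuple c (rev_ord p) | p < n].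
Proof.
rewrite sign_perm_inversions; apply: eq_bigr => p _; apply: eq_bigr => q lt_pq.
rewrite !permE /= dropped_card_lt !tnth_mktuple /below /=.
have -> : (n - p.+1 < n - q.+1)%N = false.
  by apply/negbTE; rewrite -leqNgt leq_sub2l // ltnW.
by rewrite andbF orbF.
Qed.

(** For each [c], only [w = standardization c] and the cut [packets c] contribute, so an expectation
    over shuffles is an average over words. *)
Lemma sum_shuffle_law (R : realFieldType) (f : 'S_n -> R) :
  \sum_w shuffle_law R a w * f w
    = (a%:R ^+ n)^-1 * \sum_(c : drops n a) f (standardization c).
Proof.
transitivity (\sum_w \sum_(c : drops n a)
    \sum_(j : cut n a | valid_cut j && shuffle_result j c w)
      cut_prob R j * drop_prob R j c * f w).
  apply: eq_bigr => w _; rewrite /shuffle_law mulr_suml.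
  under eq_bigr do rewrite mulr_suml big_mkcond.
  rewrite exchange_big; apply: eq_bigr => c _.
  by rewrite -big_mkcondr.
rewrite exchange_big mulr_sumr; apply: eq_bigr => c _ /=.
rewrite (bigD1 (standardization c)) //= [X in _ + X]big1 ?addr0 => [|w ne_w].
  rewrite (bigD1 (packets c)) /=; last first.
    by rewrite valid_packets shuffle_result_packets eqxx.
  rewrite cut_drop_prob ?valid_packets // eqxx big1 ?addr0 // => j.
  by case/andP=> /andP[valid_j _] /negbTE ne_j; rewrite cut_drop_prob // ne_j mul0r.
apply: big1 => j /andP[valid_j res]; rewrite cut_drop_prob //.
case: eqVneq res => [->|_ _]; last by rewrite mul0r.
by rewrite shuffle_result_packets (negbTE ne_w).
Qed.

End Packets.

(** * Expected sign of one shuffle and of [k] shuffles *)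

Lemma sum_shuffle_law1 (R : realFieldType) (n a : nat) : (0 < a)%N ->
  \sum_(w : 'S_n) shuffle_law R a w = 1.
Proof.
move=> a_gt0; have := @sum_shuffle_law n a R (fun=> 1).
under eq_bigr do rewrite mulr1.
move->; rewrite sumr_const card_ffun !card_ord -natrX mulVf //.
by rewrite pnatr_eq0 -lt0n expn_gt0 a_gt0.
Qed.

Lemma sum_shuffle_law_sign (R : realFieldType) (n a : nat) : (0 < a)%N ->
  \sum_(w : 'S_n) shuffle_law R a w * (-1) ^+ odd_perm w = (a%:R ^+ (n %/ 2))^-1.
Proof.
move=> a_gt0; rewrite sum_shuffle_law.
under eq_bigr do rewrite sign_standardization.
have -> : \sum_(c : drops n a) word_sign R n a [tuple c (rev_ord p) | p < n]
          = a%:R ^+ uphalf n.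
  rewrite -sum_word_sign [RHS](reindex (fun c : drops n a =>
    [tuple c (rev_ord p) | p < n])) //.
  exists (fun t : n.-tuple 'I_a => [ffun p => tnth t (rev_ord p)]) => [c|t] _.
    by apply/ffunP => p; rewrite ffunE tnth_mktuple rev_ordK.
  by apply: eq_from_tnth => p; rewrite tnth_mktuple ffunE rev_ordK.
have a0 : a%:R != 0 :> R by rewrite pnatr_eq0 -lt0n.
have {1}-> : n = (n./2 + uphalf n)%N.
  by rewrite uphalf_half addnCA addnn odd_double_half.
rewrite divn2 exprD.
by rewrite invfM -mulrA mulVf ?mulr1 // expf_neq0.
Qed.

Lemma sign_shuffled_deck (R : pzRingType) (n k : nat) (s : k.-tuple 'S_n) :
  (-1) ^+ odd_perm (shuffled_deck s) = \prod_(i < k) (-1) ^+ odd_perm (tnth s i) :> R.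
Proof.
rewrite -(big_tuple _ _ s predT (fun w => (-1) ^+ odd_perm w)) /shuffled_deck.
suff sgn_foldl u (ws : seq 'S_n) : (-1) ^+ odd_perm (foldl (@rearrange n) u ws)
    = (-1) ^+ odd_perm u * \prod_(w <- ws) (-1) ^+ odd_perm w :> R.
  by rewrite sgn_foldl odd_perm1 mul1r.
elim: ws u => [|w ws IHws] u /=; first by rewrite big_nil mulr1.
by rewrite IHws big_cons mulrA /rearrange odd_permM addbC signr_addb.
Qed.

Theorem theorem1p4 (R : realFieldType) (n a k : nat)
    (hn : (1 <= n)%N) (ha : (1 <= a)%N) :
  shuffles_prob R a k [pred w : 'S_n | sgn w == 1]
    = 1 / 2 + 1 / (2 * a%:R ^+ (k * (n %/ 2))).
Proof.
pose law (s : k.-tuple 'S_n) : R := \prod_(i < k) shuffle_law R a (tnth s i).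
(* The indicator of sign 1 is half of 1 plus the sign; the two halves yield the total mass and the
   expected sign. *)
have -> : shuffles_prob R a k [pred w : 'S_n | sgn w == 1]
    = \sum_(s : k.-tuple 'S_n)
        (law s / 2 + law s * (-1) ^+ odd_perm (shuffled_deck s) / 2).
  rewrite /shuffles_prob big_mkcond; apply: eq_bigr => s _.
  rewrite -/(law s) /= /sgn; case: odd_perm => /=.
    by rewrite mulrN1 mulNr subrr.
  by rewrite mulr1 -splitr.
rewrite big_split -!mulr_suml /= sum_tuple_prod sum_shuffle_law1 // expr1n.
under eq_bigr do rewrite sign_shuffled_deck -big_split.
rewrite (sum_tuple_prod _ _ (fun w => shuffle_law R a w * (-1) ^+ odd_perm w)).
by rewrite sum_shuffle_law_sign // exprVn -exprM mulnC invfM !mul1r mulrC.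
Qed.
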